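(* Let $A$ be a graded Adem-Cartan algebra, i.e. an algebra over the operad $\mathcal{L}ev^{AC}$ whose differential is zero. Then $A$, with product $x*y=e_0(x,y)$ and operations $\mathrm{Sq}^r(x)=e_{|x|-r}(x,x)$ ($r\in\mathbb Z$, $x$ homogeneous, $e_i=0$ for $i<0$), is an unstable level algebra over the extended Steenrod algebra $\mathcal B_2$.
   Context: The ground field is $\mathbb F_2$; ''vector space'' means differential $\mathbb Z$-graded $\mathbb F_2$-vector space with differential of degree $+1$. A permutation $\sigma\in\Sigma_n$ is written $(\sigma(1)\ldots\sigma(n))$; products are compositions of functions. An operad $\mathcal O=\{\mathcal O(n)\}_{n>0}$ consists of right differential graded $\mathbb F_2[\Sigma_n]$-modules with $\mathcal O(1)=\mathbb F_2$ and associative, unital, equivariant compositions, with $(o\cdot\sigma)(a_1,\ldots,a_n)=o(a_{\sigma^{-1}(1)},\ldots,a_{\sigma^{-1}(n)})\cdot\sigma(i_1,\ldots,i_n)$ (block permutation). An $\mathcal O$-algebra $A$ is a vector space with associative, equivariant evaluation maps $\mathcal O(n)\otimes A^{\otimes n}\to A$ (chain maps), $(o\cdot\sigma)(a_1,\ldots,a_n)=o(a_{\sigma^{-1}(1)},\ldots,a_{\sigma^{-1}(n)})$. $\mathcal E$: free operad on the $\Sigma_2$-module with basis over $\mathbb F_2[\Sigma_2]$ given by $e_i$ in degree $-i$, $i\ge0$, $d(e_i)=e_{i-1}+e_{i-1}\cdot(21)$, $e_{i}=0$ for $i<0$. For integers $i,j$, $(i,j)=\frac{(i+j)!}{i!\,j!}\in\mathbb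 F_2$ if $i,j\ge0$, and $0$ otherwise. For $m>0$ with $2^k\le m\le 2^{k+1}-1$, $[u^m_n]_x\in\mathcal E(4)^{-n-x}$ is: $[u^m_n]_x=0$ if $n<0$; $[u^m_0]_x=(e_x\cdot(21)^{m-1})(e_0,e_0)$; and for $n>0$ $$[u^m_n]_x=\sum_{i=0}^{2^{k+1}-1}\ \sum_{\delta:\,0\le 2^{k+1}\delta-i\le n}(n-m+i,m-1)\Big[(i,m)\,(e_x\cdot(21)^{m-1})(e_{2^{k+1}\delta-i},e_{n+i-2^{k+1}\delta})+(i-1,m)\,(e_x\cdot(21)^{m-1})(e_{2^{k+1}\delta-i},e_{n+i-2^{k+1}\delta}\cdot(21))\Big].$$ For $p\in\mathbb Z$, $\alpha_{n,p}=\sum_{s=0}^{n-p}[u^{s+1}_{s+p}]_{n-s-p}+\sum_{s=0}^{n-p-1}[u^{s+1}_{s+p+1}]_{n-s-p-1}\cdot(3412)\in\mathcal E(4)^{-n}$. $\mathcal{L}ev^{AC}$ is the operad which, forgetting the differential, is the free operad on the $\Sigma_2$-module $\mathcal E(2)$ and the free $\Sigma_4$-module on elements $G^m_n$ of degree $-n$, $n\ge m\ge1$, with differential extending that of $\mathcal E$ and given, with $p=\lfloor\frac{m-1}2\rfloor$ and $G^m_n=0$ if $m\le0$ or $n<m$, by $$dG^m_m=G^{m-1}_{m-1}\cdot(3214)(\mathrm{Id}+(2143))+G^{m-2}_{m-1}\cdot(\mathrm{Id}+(4321))+\alpha_{m-1,m-1-p}+\alpha_{m-1,p}\cdot(3214),$$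 $$dG^m_n=G^m_{n-1}\cdot(\mathrm{Id}+(2143))+G^{m-2}_{n-1}\cdot(\mathrm{Id}+(4321))+\alpha_{n-1,n-1-p}+\alpha_{n-1,p}\cdot(3214)\quad(n>m).$$ The extended Steenrod algebra $\mathcal B_2$ is the graded associative $\mathbb F_2$-algebra generated by $\mathrm{Sq}^i$ of degree $i$, $i\in\mathbb Z$, subject to the Adem relations $\mathrm{Sq}^t\mathrm{Sq}^s=\sum_i\binom{s-i-1}{t-2i}\mathrm{Sq}^{s+t-i}\mathrm{Sq}^i$ for $t<2s$ (binomials $\binom ab$ vanish unless $0\le b\le a$; $\mathrm{Sq}^0=\mathrm{Id}$ is not assumed). A level algebra is a vector space with a commutative (not necessarily associative) product $*$ with $(a*b)*(c*d)=(a*c)*(b*d)$. An unstable level algebra over $\mathcal B_2$ is a graded level algebra $(A,* )$ that is a graded $\mathcal B_2$-module with $\mathrm{Sq}^n(x)=0$ if $|x|<n$, $\mathrm{Sq}^{|x|}(x)=x*x$, and $\mathrm{Sq}^s(x*y)=\sum_{t}\mathrm{Sq}^t(x)*\mathrm{Sq}^{s-t}(y)$. *)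

(* Defs.v *)
(* The ground field is F_2, so there are no Koszul signs. *)
From HB Require Import structures.
From mathcomp Require Import all_boot all_order all_fingroup all_algebra.
From mathcomp Require Import boolp classical_sets fsbigop.

Set Implicit Arguments.
Unset Strict Implicit.
Unset Printing Implicit Defensive.

Import generic_quotient GRing.Theory.

Local Open Scope ring_scope.
Local Open Scope quotient_scope.

(* A Z-grading is an internal direct sum decomposition, given by the projections
   on the homogeneous components: orthogonal idempotents such that every vector
   is the sum of finitely many of its components. *)
Record gradedSpace := GradedSpace {
  gs_sort :> lmodType 'F_2;
  gs_proj : int -> gs_sort -> gs_sort;
  gs_proj_linear : forall k, linear (gs_proj k);
  gs_projK : forall k l v,
    gs_proj k (gs_proj l v) = if k == l then gs_proj l v else 0;
  gs_proj_sum : forall v, exists2 s : seq int,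
    uniq s & v = \sum_(k <- s) gs_proj k v }.

Definition homog (V : gradedSpace) (k : int) (v : V) : Prop := gs_proj k v = v.

Definition castar (V : nat -> gradedSpace) (m n : nat) (E : m = n) (x : V m) : V n :=
  ecast i (gs_sort (V i)) E x.

(* [tagnat.Rank i j] is the position of the [j]-th entry of the [i]-th block in
   the concatenation of consecutive blocks of sizes [a 0], ..., [a k.-1].

   The permutation s(a_1, ..., a_k) moves the [j]-th block to the [s j]-th place:
   the blocks standing before it are then those [i] with [s i < s j]. *)
Definition is_block_perm (k : nat) (a : 'I_k -> nat) (s : 'S_k)
    (B : 'S_(\sum_i a i)) : Prop :=
  forall (j : 'I_k) (t : 'I_(a j)),
    B (tagnat.Rank j t) = (\sum_(i < k | (s i < s j)%N) a i + t)%N :> nat.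

Definition is_sum_perm (k : nat) (a : 'I_k -> nat) (t : forall i, 'S_(a i))
    (B : 'S_(\sum_i a i)) : Prop :=
  forall (i : 'I_k) (j : 'I_(a i)),
    B (tagnat.Rank i j) = tagnat.Rank i (t i j).

(* Graded operads with O(0) = 0 and O(1) = F_2.  The products of 'S_n are
   written by MathComp in the order opposite to that of compositions of
   functions: [(t * s)%g] is the function s \o t. *)
Record gradedOperad := GradedOperad {
  op :> nat -> gradedSpace;
  opact : forall n, op n -> 'S_n -> op n;
  opid : op 1;
  opcomp : forall (k : nat) (a : 'I_k -> nat),
    op k -> (forall i, op (a i)) -> op (\sum_i a i)%N;
  op0 : forall x : op 0, x = 0;
  opid_neq0 : opid != 0;
  op1 : forall x : op 1, exists c : 'F_2, x = c *: opid;
  act_linear : forall n (s : 'S_n), linear (fun x : op n => opact x s);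
  act_homog : forall n (x : op n) (s : 'S_n) (k : int),
    homog k x -> homog k (opact x s);
  act_1 : forall n (x : op n), opact x 1%g = x;
  act_M : forall n (x : op n) (s t : 'S_n),
    opact (opact x s) t = opact x (t * s)%g;
  opid_homog : homog 0 opid;
  comp_linearl : forall k (a : 'I_k -> nat) (p : forall i, op (a i)),
    linear (fun o : op k => opcomp o p);
  comp_linearr : forall k (a : 'I_k -> nat) (o : op k)
      (p : forall i, op (a i)) (i : 'I_k),
    linear (fun x : op (a i) => opcomp o (@dfwith _ (fun j => op (a j)) p i x));
  comp_homog : forall k (a : 'I_k -> nat) (o : op k) (p : forall i, op (a i))
      (c : int) (l : 'I_k -> int),
    homog c o -> (forall i, homog (l i) (p i)) ->
    homog (c + \sum_i l i) (opcomp o p);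
  comp_idl : forall n (x : op n) (E : (\sum_(i < 1) n)%N = n),
    castar E (@opcomp 1 (fun=> n) opid (fun=> x)) = x;
  comp_idr : forall n (x : op n) (E : (\sum_(i < n) 1)%N = n),
    castar E (@opcomp n (fun=> 1%N) x (fun=> opid)) = x;
  comp_assoc : forall k (a : 'I_k -> nat) (o : op k) (p : forall i, op (a i))
      (c : 'I_(\sum_i a i) -> nat) (q : forall l, op (c l))
      (E : (\sum_l c l)%N = (\sum_i \sum_(j < a i) c (tagnat.Rank i j))%N),
    castar E (opcomp (opcomp o p) q) =
    opcomp o (fun i => opcomp (p i) (fun j => q (tagnat.Rank i j)));
  comp_actl : forall k (a : 'I_k -> nat) (o : op k) (p : forall i, op (a i))
      (s : 'S_k) (B : 'S_(\sum_i a i))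
      (E : (\sum_i a ((s^-1)%g i))%N = (\sum_i a i)%N),
    is_block_perm s B ->
    opcomp (opact o s) p = opact (castar E (opcomp o (fun i => p ((s^-1)%g i)))) B;
  comp_actr : forall k (a : 'I_k -> nat) (o : op k) (p : forall i, op (a i))
      (t : forall i, 'S_(a i)) (B : 'S_(\sum_i a i)),
    is_sum_perm t B ->
    opcomp o (fun i => opact (p i) (t i)) = opact (opcomp o p) B }.

Record isOperadMorphism (P Q : gradedOperad) (f : forall n, P n -> Q n) : Prop := {
  mor_linear : forall n, linear (f n);
  mor_homog : forall n (x : P n) (k : int), homog k x -> homog k (f n x);
  mor_act : forall n (x : P n) (s : 'S_n), f n (opact x s) = opact (f n x) s;
  mor_id : f 1%N (opid P) = opid Q;
  mor_comp : forall k (a : 'I_k -> nat) (o : P k) (p : forall i, P (a i)),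
    f _ (opcomp o p) = opcomp (f k o) (fun i => f _ (p i)) }.

Record dgOperad := DgOperad {
  dg_op :> gradedOperad;
  dop : forall n, dg_op n -> dg_op n;
  dop_linear : forall n, linear (@dop n);
  dop_homog : forall n (x : dg_op n) (k : int),
    homog k x -> homog (k + 1) (dop x);
  dop_dop : forall n (x : dg_op n), dop (dop x) = 0;
  dop_act : forall n (x : dg_op n) (s : 'S_n), dop (opact x s) = opact (dop x) s;
  dop_comp : forall k (a : 'I_k -> nat) (o : dg_op k)
      (p : forall i, dg_op (a i)),
    dop (opcomp o p) = opcomp (dop o) p +
      \sum_i opcomp o (@dfwith _ (fun j => dg_op (a j)) p i (dop (p i))) }.

Record opAlgebra (P : dgOperad) := OpAlgebra {
  alg :> gradedSpace;
  dalg : alg -> alg;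
  ev : forall n, P n -> ('I_n -> alg) -> alg;
  dalg_linear : linear dalg;
  dalg_homog : forall (x : alg) (k : int), homog k x -> homog (k + 1) (dalg x);
  dalg_dalg : forall x, dalg (dalg x) = 0;
  ev_linearl : forall n (a : 'I_n -> alg), linear (fun o : P n => ev o a);
  ev_linearr : forall n (o : P n) (a : 'I_n -> alg) (i : 'I_n),
    linear (fun x : alg => ev o (@dfwith _ (fun=> gs_sort alg) a i x));
  ev_homog : forall n (o : P n) (a : 'I_n -> alg) (c : int) (l : 'I_n -> int),
    homog c o -> (forall i, homog (l i) (a i)) ->
    homog (c + \sum_i l i) (ev o a);
  ev_d : forall n (o : P n) (a : 'I_n -> alg),
    dalg (ev o a) = ev (dop o) a +
      \sum_i ev o (@dfwith _ (fun=> gs_sort alg) a i (dalg (a i)));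
  ev_id : forall a : 'I_1 -> alg, ev (opid P) a = a ord0;
  ev_comp : forall k (b : 'I_k -> nat) (o : P k) (p : forall i, P (b i))
      (a : 'I_(\sum_i b i) -> alg),
    ev (opcomp o p) a = ev o (fun i => ev (p i) (fun j => a (tagnat.Rank i j)));
  ev_act : forall n (o : P n) (s : 'S_n) (a : 'I_n -> alg),
    ev (opact o s) a = ev o (fun i => a ((s^-1)%g i)) }.

(* The permutations written (21), (3214), (2143), (4321), (3412) in one-line
   notation on {1, ..., n}; here the points are numbered from 0. *)
Definition s21 : 'S_2 := tperm 0%R 1%R.
Definition s3214 : 'S_4 := tperm 0%R 2%R.
Definition s2143 : 'S_4 := (tperm 0%R 1%R * tperm 2%R 3%R)%g.
Definition s4321 : 'S_4 := (tperm 0%R 3%R * tperm 1%R 2%R)%g.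
Definition s3412 : 'S_4 := (tperm 0%R 2%R * tperm 1%R 3%R)%g.

Definition args2 (T : Type) (x y : T) : 'I_2 -> T :=
  fun i => if i == ord0 then x else y.

Lemma sum22 : (\sum_(i < 2) 2)%N = 4%N.
Proof. by rewrite !big_ord_recl big_ord0. Qed.

Definition comp2 (P : gradedOperad) (o p q : P 2%N) : P 4%N :=
  castar sum22 (@opcomp P 2%N (fun=> 2%N) o (args2 p q)).

Definition ev2 (P : dgOperad) (A : opAlgebra P) (o : P 2%N) (x y : A) : A :=
  ev o (args2 x y).

(* (i, j) = (i + j)! / (i! j!) mod 2 *)
Definition multi (i j : int) : 'F_2 :=
  if (0 <= i) && (0 <= j) then 'C(absz i + absz j, absz i)%:R else 0.

Section CupElements.

Variables (P : gradedOperad) (e : nat -> P 2%N).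

Definition ez (i : int) : P 2%N := if 0 <= i then e (absz i) else 0.

(* [u^m_n]_x for m > 0; [trunc_log 2 m] is the k with 2^k <= m <= 2^(k+1) - 1.
   Since i < 2^(k+1), the condition 0 <= 2^(k+1) delta - i <= n forces
   0 <= delta <= n + i. *)
Definition uterm (m : nat) (n x : int) : P 4%N :=
  let ex := opact (ez x) (s21 ^+ m.-1)%g in
  let K := (2 ^ (trunc_log 2 m).+1)%N in
  match n with
  | Negz _ => 0
  | Posz 0 => comp2 ex (e 0) (e 0)
  | Posz n =>
    \sum_(0 <= i < K)
      \sum_(0 <= delta < (n + i).+1 | (i <= K * delta <= n + i)%N)
        multi (n%:Z - m%:Z + i%:Z) (m%:Z - 1) *:
          (multi i%:Z m%:Z *:
             comp2 ex (e (K * delta - i)%N) (e (n + i - K * delta)%N)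
           + multi (i%:Z - 1) m%:Z *:
             comp2 ex (e (K * delta - i)%N)
                      (opact (e (n + i - K * delta)%N) s21))
  end.

(* number of integers s with 0 <= s <= z *)
Definition upto (z : int) : nat := if 0 <= z then (absz z).+1 else 0%N.

Definition alpha (n p : int) : P 4%N :=
  \sum_(0 <= s < upto (n - p)) uterm s.+1 (s%:Z + p) (n - s%:Z - p)
  + \sum_(0 <= s < upto (n - p - 1))
      opact (uterm s.+1 (s%:Z + p + 1) (n - s%:Z - p - 1)) s3412.

End CupElements.

(* x . (Id + s) *)
Definition act_id_plus (P : gradedOperad) n (x : P n) (s : 'S_n) : P n :=
  x + opact x s.

(* The graded operad [P] is free on the free F_2[S_2]-module with basis the
   e_i, |e_i| = -i, and the free F_2[S_4]-module with basis the G^m_n,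
   |G^m_n| = -n, n >= m >= 1: a morphism of operads out of [P] amounts to
   the choice of the images of these basis elements. *)
Definition freely_generated (P : gradedOperad)
    (e : nat -> P 2%N) (G : nat -> nat -> P 4%N) : Prop :=
  forall (Q : gradedOperad) (e' : nat -> Q 2%N) (G' : nat -> nat -> Q 4%N),
    (forall i, homog (- i%:Z) (e' i)) ->
    (forall m n, (0 < m <= n)%N -> homog (- n%:Z) (G' m n)) ->
    let extends (f : forall n, P n -> Q n) :=
      [/\ isOperadMorphism f, forall i, f 2%N (e i) = e' i
        & forall m n, (0 < m <= n)%N -> f 4%N (G m n) = G' m n] in
    exists2 f, extends f & forall g, extends g -> forall n x, g n x = f n x.

(* [G m n] is G^m_n.  Truncated subtraction on the upper index is harmless as
   G^m_n = 0 for m <= 0. *)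
Record isLevAC (P : dgOperad)
    (e : nat -> P 2%N) (G : nat -> nat -> P 4%N) : Prop := {
  lev_e_homog : forall i, homog (- i%:Z) (e i);
  lev_G_homog : forall m n, (0 < m <= n)%N -> homog (- n%:Z) (G m n);
  lev_G0 : forall m n, ~~ (0 < m <= n)%N -> G m n = 0;
  lev_free : freely_generated e G;
  lev_de : forall i, dop (e i) = act_id_plus (ez e (i%:Z - 1)) s21;
  lev_dG_diag : forall m, (0 < m)%N ->
    let p := (m.-1./2)%N in
    dop (G m m) =
      act_id_plus (opact (G m.-1 m.-1) s3214) s2143
      + act_id_plus (G (m - 2)%N m.-1) s4321
      + alpha e (m%:Z - 1) (m%:Z - 1 - p%:Z)
      + opact (alpha e (m%:Z - 1) p%:Z) s3214;
  lev_dG : forall m n, (0 < m < n)%N ->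
    let p := (m.-1./2)%N in
    dop (G m n) =
      act_id_plus (G m n.-1) s2143
      + act_id_plus (G (m - 2)%N n.-1) s4321
      + alpha e (n%:Z - 1) (n%:Z - 1 - p%:Z)
      + opact (alpha e (n%:Z - 1) p%:Z) s3214 }.

Definition zbin (a b : int) : nat :=
  if (0 <= b) && (b <= a) then 'C(absz a, absz b) else 0%N.

(* [B2] is the F_2-algebra presented by the generators Sq^i and the Adem
   relations: formal expressions modulo the least congruence containing the
   axioms of associative unital algebras and the relations. *)
Inductive b2pre : Type :=
  | b2zero | b2one | b2sq of int
  | b2add of b2pre & b2pre | b2mul of b2pre & b2pre | b2scale of 'F_2 & b2pre.

Inductive b2eq : b2pre -> b2pre -> Prop :=
  | b2_refl x : b2eq x x
  | b2_sym x y : b2eq x y -> b2eq y x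
  | b2_trans x y z : b2eq x y -> b2eq y z -> b2eq x z
  | b2_add_congr x x' y y' :
      b2eq x x' -> b2eq y y' -> b2eq (b2add x y) (b2add x' y')
  | b2_mul_congr x x' y y' :
      b2eq x x' -> b2eq y y' -> b2eq (b2mul x y) (b2mul x' y')
  | b2_scale_congr c x x' : b2eq x x' -> b2eq (b2scale c x) (b2scale c x')
  | b2_addA x y z : b2eq (b2add x (b2add y z)) (b2add (b2add x y) z)
  | b2_addC x y : b2eq (b2add x y) (b2add y x)
  | b2_add0 x : b2eq (b2add b2zero x) x
  | b2_mulA x y z : b2eq (b2mul x (b2mul y z)) (b2mul (b2mul x y) z)
  | b2_mul1l x : b2eq (b2mul b2one x) x
  | b2_mul1r x : b2eq (b2mul x b2one) x
  | b2_mulDl x y z : b2eq (b2mul (b2add x y) z) (b2add (b2mul x z) (b2mul y z))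
  | b2_mulDr x y z : b2eq (b2mul x (b2add y z)) (b2add (b2mul x y) (b2mul x z))
  | b2_scaleA c d x : b2eq (b2scale c (b2scale d x)) (b2scale (c * d) x)
  | b2_scale0 x : b2eq (b2scale 0 x) b2zero
  | b2_scale1 x : b2eq (b2scale 1 x) x
  | b2_scaleDr c x y :
      b2eq (b2scale c (b2add x y)) (b2add (b2scale c x) (b2scale c y))
  | b2_scaleDl (c d : 'F_2) x :
      b2eq (b2scale (c + d) x) (b2add (b2scale c x) (b2scale d x))
  | b2_scaleAl c x y : b2eq (b2scale c (b2mul x y)) (b2mul (b2scale c x) y)
  | b2_scaleAr c x y : b2eq (b2scale c (b2mul x y)) (b2mul x (b2scale c y))
  (* The sum is over all integers i; it is finite, its coefficients being zero
     unless t - s < i <= t / 2, and [r] is any list without repetitions of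
     indices that contains those with a nonzero coefficient. *)
  | b2_adem (t s : int) (r : seq int) :
      t < 2 * s -> uniq r ->
      (forall i : int, zbin (s - i - 1) (t - 2 * i) != 0%N -> i \in r) ->
      b2eq (b2mul (b2sq t) (b2sq s))
        (foldr (fun i : int => b2add (b2scale (zbin (s - i - 1) (t - 2 * i))%:R
                                  (b2mul (b2sq (s + t - i)) (b2sq i))))
               b2zero r).

HB.instance Definition _ := gen_eqMixin b2pre.
HB.instance Definition _ := gen_choiceMixin b2pre.

Definition b2rel : rel b2pre := fun x y => `[< b2eq x y >].

Lemma b2rel_refl : reflexive b2rel.
Proof. by move=> x; apply/asboolP; exact: b2_refl. Qed.

Lemma b2rel_sym : symmetric b2rel.
Proof. by move=> x y; apply/asboolP/asboolP; exact: b2_sym. Qed.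

Lemma b2rel_trans : transitive b2rel.
Proof.
by move=> y x z /asboolP xy /asboolP yz; apply/asboolP; exact: b2_trans xy yz.
Qed.

Canonical b2equiv := EquivRel b2rel b2rel_refl b2rel_sym b2rel_trans.

Definition B2 : Type := {eq_quot b2equiv}.
HB.instance Definition _ : EqQuotient _ b2equiv B2 := EqQuotient.on B2.
HB.instance Definition _ := Choice.on B2.

Lemma b2_piP (x y : b2pre) : \pi_B2 x = \pi_B2 y <-> b2eq x y.
Proof.
split; first by move/eqmodP => /asboolP.
by move=> xy; apply/eqmodP/asboolP.
Qed.

Lemma b2_reprK (x : b2pre) : b2eq (repr (\pi_B2 x)) x.
Proof. by apply/b2_piP; rewrite reprK. Qed.

Definition B2zero : B2 := \pi_B2 b2zero.
Definition B2one : B2 := \pi_B2 b2one.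
Definition B2add (x y : B2) : B2 := \pi_B2 (b2add (repr x) (repr y)).
Definition B2mul (x y : B2) : B2 := \pi_B2 (b2mul (repr x) (repr y)).
Definition B2scale (c : 'F_2) (x : B2) : B2 := \pi_B2 (b2scale c (repr x)).
Definition B2opp (x : B2) : B2 := B2scale (-1) x.

Lemma B2addE x y : B2add (\pi_B2 x) (\pi_B2 y) = \pi_B2 (b2add x y).
Proof. by apply/b2_piP/b2_add_congr; exact: b2_reprK. Qed.

Lemma B2mulE x y : B2mul (\pi_B2 x) (\pi_B2 y) = \pi_B2 (b2mul x y).
Proof. by apply/b2_piP/b2_mul_congr; exact: b2_reprK. Qed.

Lemma B2scaleE c x : B2scale c (\pi_B2 x) = \pi_B2 (b2scale c x).
Proof. by apply/b2_piP/b2_scale_congr; exact: b2_reprK. Qed.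

Lemma B2ind (T : B2 -> Prop) : (forall x, T (\pi_B2 x)) -> forall x, T x.
Proof. by move=> H x; rewrite -[x]reprK. Qed.

Lemma B2addA : associative B2add.
Proof.
by elim/B2ind=> x; elim/B2ind=> y; elim/B2ind=> z; rewrite !B2addE;
   apply/b2_piP/b2_addA.
Qed.

Lemma B2addC : commutative B2add.
Proof.
by elim/B2ind=> x; elim/B2ind=> y; rewrite !B2addE; apply/b2_piP/b2_addC.
Qed.

Lemma B2add0 : left_id B2zero B2add.
Proof. by elim/B2ind=> x; rewrite /B2zero B2addE; apply/b2_piP/b2_add0. Qed.

Lemma B2addN : left_inverse B2zero B2opp B2add.
Proof.
elim/B2ind=> x; rewrite /B2opp B2scaleE B2addE; apply/b2_piP.
apply: b2_trans (b2_add_congr (b2_refl _) (b2_sym (b2_scale1 x))) _.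
apply: b2_trans (b2_sym (b2_scaleDl _ _ _)) _.
by rewrite addNr; exact: b2_scale0.
Qed.

HB.instance Definition _ :=
  GRing.isZmodule.Build B2 B2addA B2addC B2add0 B2addN.

Lemma B2mulA : associative B2mul.
Proof.
by elim/B2ind=> x; elim/B2ind=> y; elim/B2ind=> z; rewrite !B2mulE;
   apply/b2_piP/b2_mulA.
Qed.

Lemma B2mul1l : left_id B2one B2mul.
Proof. by elim/B2ind=> x; rewrite /B2one B2mulE; apply/b2_piP/b2_mul1l. Qed.

Lemma B2mul1r : right_id B2one B2mul.
Proof. by elim/B2ind=> x; rewrite /B2one B2mulE; apply/b2_piP/b2_mul1r. Qed.

Lemma B2mulDl : left_distributive B2mul +%R.
Proof.
elim/B2ind=> x; elim/B2ind=> y; elim/B2ind=> z; rewrite /GRing.add /=.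
by rewrite !(B2mulE, B2addE); apply/b2_piP/b2_mulDl.
Qed.

Lemma B2mulDr : right_distributive B2mul +%R.
Proof.
elim/B2ind=> x; elim/B2ind=> y; elim/B2ind=> z; rewrite /GRing.add /=.
by rewrite !(B2mulE, B2addE); apply/b2_piP/b2_mulDr.
Qed.

Fixpoint b2aug (x : b2pre) : 'F_2 :=
  match x with
  | b2zero => 0
  | b2one => 1
  | b2sq _ => 0
  | b2add x y => b2aug x + b2aug y
  | b2mul x y => b2aug x * b2aug y
  | b2scale c x => c * b2aug x
  end.

Lemma b2aug_eq x y : b2eq x y -> b2aug x = b2aug y.
Proof.
elim=> {x y} //=; try by move=> *; congruence.
- by move=> *; rewrite addrA.
- by move=> *; rewrite addrC.
- by move=> *; rewrite add0r.
- by move=> *; rewrite mulrA.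
- by move=> *; rewrite mul1r.
- by move=> *; rewrite mulr1.
- by move=> *; rewrite mulrDl.
- by move=> *; rewrite mulrDr.
- by move=> *; rewrite mulrA.
- by move=> *; rewrite mul0r.
- by move=> *; rewrite mul1r.
- by move=> *; rewrite mulrDr.
- by move=> *; rewrite mulrDl.
- by move=> *; rewrite mulrA.
- by move=> *; rewrite mulrCA.
move=> t s r _ _ _; rewrite mul0r.
by elim: r => //= i r <-; rewrite mul0r mulr0 addr0.
Qed.

Lemma B2one_neq0 : B2one != 0.
Proof. by apply/eqP => /b2_piP/b2aug_eq/eqP; rewrite oner_eq0. Qed.

HB.instance Definition _ := GRing.Zmodule_isNzRing.Build B2
  B2mulA B2mul1l B2mul1r B2mulDl B2mulDr B2one_neq0.

Lemma B2scaleA c d x : B2scale c (B2scale d x) = B2scale (c * d) x.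
Proof. by elim/B2ind: x => x; rewrite !B2scaleE; apply/b2_piP/b2_scaleA. Qed.

Lemma B2scale1 : left_id 1 B2scale.
Proof. by elim/B2ind=> x; rewrite B2scaleE; apply/b2_piP/b2_scale1. Qed.

Lemma B2scaleDr : right_distributive B2scale +%R.
Proof.
move=> c; elim/B2ind=> x; elim/B2ind=> y; rewrite /GRing.add /=.
by rewrite !(B2scaleE, B2addE); apply/b2_piP/b2_scaleDr.
Qed.

Lemma B2scaleDl x : {morph B2scale^~ x : c d / c + d}.
Proof.
move=> c d; elim/B2ind: x => x; rewrite [in RHS]/GRing.add /=.
by rewrite !(B2scaleE, B2addE); apply/b2_piP/b2_scaleDl.
Qed.

HB.instance Definition _ := GRing.Zmodule_isLmodule.Build 'F_2 B2
  B2scaleA B2scale1 B2scaleDr B2scaleDl.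

Lemma B2scaleAl (c : 'F_2) (x y : B2) : c *: (x * y) = c *: x * y.
Proof.
elim/B2ind: x => x; elim/B2ind: y => y; rewrite /GRing.scale /GRing.mul /=.
by rewrite !(B2scaleE, B2mulE); apply/b2_piP/b2_scaleAl.
Qed.

Lemma B2scaleAr (c : 'F_2) (x y : B2) : c *: (x * y) = x * (c *: y).
Proof.
elim/B2ind: x => x; elim/B2ind: y => y; rewrite /GRing.scale /GRing.mul /=.
by rewrite !(B2scaleE, B2mulE); apply/b2_piP/b2_scaleAr.
Qed.

HB.instance Definition _ :=
  GRing.LSemiModule_isLSemiAlgebra.Build 'F_2 B2 B2scaleAl.
HB.instance Definition _ :=
  GRing.LSemiAlgebra_isSemiAlgebra.Build 'F_2 B2 B2scaleAr.

Definition Sq (i : int) : B2 := \pi_B2 (b2sq i).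

(* the span of the monomials Sq^(i_1) ... Sq^(i_l) with i_1 + ... + i_l = k *)
Definition B2homog (k : int) (b : B2) : Prop :=
  exists2 ws : seq (seq int),
    all (fun w => \sum_(i <- w) i == k) ws
    & b = \sum_(w <- ws) \prod_(i <- w) Sq i.

Record isGradedB2Module (A : gradedSpace) (b2act : B2 -> A -> A) : Prop := {
  b2act_linearl : forall x, linear (b2act^~ x);
  b2act_linearr : forall b, linear (b2act b);
  b2act_1 : forall x, b2act 1 x = x;
  b2act_M : forall b c x, b2act (b * c) x = b2act b (b2act c x);
  b2act_homog : forall (k l : int) (b : B2) (x : A),
    B2homog k b -> homog l x -> homog (k + l) (b2act b x) }.

Record isGradedLevelAlgebra (A : gradedSpace) (mul : A -> A -> A) : Prop := {
  level_linearl : forall y, linear (mul^~ y);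
  level_linearr : forall x, linear (mul x);
  level_homog : forall (k l : int) (x y : A),
    homog k x -> homog l y -> homog (k + l) (mul x y);
  level_C : commutative mul;
  level_interchange : interchange mul mul }.

(* The sum in the Cartan formula is over all integers t; it has finite support
   by instability. *)
Record isUnstableLevelAlgebra (A : gradedSpace) (mul : A -> A -> A)
    (b2act : B2 -> A -> A) : Prop := {
  ula_level : isGradedLevelAlgebra mul;
  ula_module : isGradedB2Module b2act;
  ula_unstable : forall (k n : int) (x : A),
    homog k x -> k < n -> b2act (Sq n) x = 0;
  ula_square : forall (k : int) (x : A),
    homog k x -> b2act (Sq k) x = mul x x;
  ula_cartan : forall (k l s : int) (x y : A), homog k x -> homog l y ->
    b2act (Sq s) (mul x y) =
    \sum_(t \in [set: int]%classic)
      mul (b2act (Sq t) x) (b2act (Sq (s - t)) y) }.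

(* Main.v *)
(* As the differential of [A] is zero, all boundaries of the operad act by zero
   on [A].  Applied to [d e_(i+1)], this says that every [e_i] is symmetric on
   [A].  Hence [Sq^r] is additive, and [u^m_n]_x acts as the sum over b + c = n
   of binom(b-1, m-1) binom(c-1, m-1) e_x(e_b, e_c).  The terms of [d G^m_n]
   that contain a generator [G] carry a factor Id + sigma, which is zero on
   arguments that sigma preserves.  Thus [d G^1_1] gives the interchange law,
   [d G^1_n] on (x, x, y, y) gives the Cartan formula, and [d G^m_n] on
   (x, x, x, x) gives the Adem relations in the symmetric form of Bullett and
   Macdonald: with Q_b = e_(N-2b)(e_b(x, x), e_b(x, x)), the polynomial
   \sum_b Q_b z^b (1 + z)^b is palindromic of degree N.  The usual Adem
   relations follow by extracting residues. *)
Require Import Defs.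
From HB Require Import structures.
From mathcomp Require Import all_boot all_order all_fingroup all_algebra.
From mathcomp Require Import boolp classical_sets fsbigop zify.

Set Implicit Arguments.
Unset Strict Implicit.
Unset Printing Implicit Defensive.

Import generic_quotient Order.TTheory GRing.Theory.

Local Open Scope ring_scope.
Local Open Scope quotient_scope.

(** * Binomial coefficients modulo 2 *)

Lemma addF2 (V : lmodType 'F_2) (v : V) : v + v = 0.
Proof.
by rewrite -[v]scale1r -scalerDl (_ : 1 + 1 = 0) ?scale0r //; apply: val_inj.
Qed.

Lemma addF2_eq0 (V : lmodType 'F_2) (u v : V) : u + v = 0 -> u = v.
Proof. by move=> uv; rewrite -[u]addr0 -(addF2 v) addrA uv add0r. Qed.

Lemma binSF2 n k : 'C(n.+1, k.+1)%:R = 'C(n, k.+1)%:R + 'C(n, k)%:R :> 'F_2.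
Proof. by rewrite binS natrD. Qed.

(** With n = 2^j d, the identity r C(n, r) = n C(n-1, r-1) shows that an odd C(n, r) would force 2^j
    to divide r. *)
Lemma bin_pow2_eq0 j d r : (0 < r < 2 ^ j)%N -> 'C(2 ^ j * d, r)%:R = 0 :> 'F_2.
Proof.
move=> /andP[r0 rj]; apply/eqP; rewrite -(@dvdn_pcharf _ 2) ?pchar_Fp //.
apply: contraLR rj => odd_bin; rewrite -leqNgt; apply: dvdn_leq => //.
rewrite -(@Gauss_dvdl _ _ 'C(2 ^ j * d, r)).
  by case: r r0 {odd_bin} => // r _; rewrite -mul_bin_diag -mulnA dvdn_mulr.
by rewrite coprimeXl // prime_coprime.
Qed.

Lemma bin_pow2D j d a r : (r < 2 ^ j)%N ->
  'C(2 ^ j * d + a, r)%:R = 'C(a, r)%:R :> 'F_2.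
Proof.
elim: a r => [|a IHa] [|r] rj; rewrite ?bin0 //; last first.
  by rewrite addnS !binSF2 !IHa // ltnW.
by rewrite addn0 bin0n bin_pow2_eq0.
Qed.

(* The binomial coefficient of [b - 1] over [r], equal to [(-1) ^ r] for
   [b = 0]. *)
Definition bin_pred (b r : nat) : 'F_2 := if b is c.+1 then 'C(c, r)%:R else 1.

Lemma bin_pred0 b : bin_pred b 0 = 1.
Proof. by case: b => //= b; rewrite bin0. Qed.

Lemma bin_predS b r : bin_pred b r.+1 + bin_pred b r = 'C(b, r.+1)%:R.
Proof.
by case: b => [|b] /=; rewrite ?binSF2 //; apply: val_inj.
Qed.

Lemma bin_pow2_pred j d c r : (r < 2 ^ j)%N -> (0 < 2 ^ j * d + c)%N ->
  'C((2 ^ j * d + c).-1, r)%:R = bin_pred c r.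
Proof.
case: c => [|c] rj; last by rewrite addnS /= bin_pow2D.
rewrite addn0 => jd0; elim: r rj => [|r IHr] rj; first by rewrite bin0.
have := bin_pow2_eq0 d (rj : 0 < r.+1 < _)%N.
case: (2 ^ j * d)%N jd0 IHr => //= n _ IHr.
by rewrite binSF2 IHr ?(ltnW rj) // => /(@addF2_eq0 ('F_2)^o).
Qed.

(** Upper negation C(r - b, r) = (-1)^r C(b - 1, r), after a shift by a multiple of 2^j that is
    invisible modulo 2 since r < 2^j. *)
Lemma bin_pow2_opp j d b r : (r < 2 ^ j)%N -> (b <= 2 ^ j * d)%N ->
  'C(2 ^ j * d - b + r, r)%:R = bin_pred b r.
Proof.
elim: b r => [|b IHb] r rj bj; first by rewrite subn0 bin_pow2D ?binn.
elim: r rj => [|r IHr] rj; first by rewrite bin0 bin_pred0.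
have <- : 'C(2 ^ j * d - b + r.+1, r.+1)%:R + 'C(2 ^ j * d - b + r, r)%:R =
    bin_pred b.+1 r.+1.
  by rewrite (IHb r.+1) ?(IHb r) ?bin_predS // ltnW.
have -> : (2 ^ j * d - b + r.+1 = (2 ^ j * d - b.+1 + r.+1).+1)%N by lia.
have -> : (2 ^ j * d - b + r = 2 ^ j * d - b.+1 + r.+1)%N by lia.
by rewrite binSF2 -addrA (addF2 (V := ('F_2)^o)) addr0.
Qed.

(* The coefficient of [z ^ m] in [(1 + z) ^ (c - r - 1)]. *)
Definition bin_diff (c r m : nat) : 'F_2 :=
  if (r < c)%N then 'C(c - r.+1, m)%:R else 'C(r - c + m, m)%:R.

Lemma bin_diff0 c r : bin_diff c r 0 = 1.
Proof. by rewrite /bin_diff; case: ifP; rewrite bin0. Qed.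

Lemma bin_diffS c r m :
  bin_diff c.+1 r m.+1 = bin_diff c r m.+1 + bin_diff c r m.
Proof.
rewrite /bin_diff; case: (ltngtP r c) => rc.
- by rewrite ltnS (ltnW rc) subSS -[(c - r)%N]prednK ?subn_gt0 // -subnS binSF2.
- rewrite ltnS leqNgt rc /=.
  rewrite (_ : (r - c + m.+1 = (r - c.+1 + m.+1).+1)%N); last by lia.
  rewrite (_ : (r - c + m = r - c.+1 + m.+1)%N); last by lia.
  by rewrite [in RHS]binSF2 -addrA (addF2 (V := ('F_2)^o)) addr0.
- by rewrite rc ltnSn !subnn !add0n !binn bin_small // (addF2 (V := ('F_2)^o)).
Qed.

(** Vandermonde's identity for the product of (1 + z)^(-r-1) and (1 + z)^c, without signs modulo
    2. *)
Lemma bin_convolution (r c m : nat) :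
  \sum_(k < m.+1) 'C(r + k, k)%:R * 'C(c, m - k)%:R = bin_diff c r m.
Proof.
elim: c m => [|c IHc] m.
  rewrite big_ord_recr /= subnn bin0 mulr1 big1 => [|k _]; last first.
    by rewrite bin0n subn_eq0 leqNgt ltn_ord mulr0.
  by rewrite add0r /bin_diff subn0.
case: m => [|m]; first by rewrite big_ord1 !bin0 bin_diff0 mulr1.
rewrite bin_diffS -!IHc big_ord_recr [X in _ = X + _]big_ord_recr /=.
rewrite subnn !bin0 addrAC; congr (_ + _).
rewrite -big_split; apply: eq_bigr => k _.
by rewrite subSn ?binSF2 ?mulrDr // -ltnS.
Qed.

Lemma bin_convolution_widen (r c m n : nat) : (m <= n)%N ->
  \sum_(k < n.+1)
    'C(r + k, k)%:R * (if (k <= m)%N then 'C(c, m - k)%:R else 0) =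
  bin_diff c r m.
Proof.
move=> mn; rewrite -bin_convolution.
rewrite (big_ord_widen n.+1 (fun k => 'C(r + k, k)%:R * 'C(c, m - k)%:R)) //.
rewrite [RHS]big_mkcond /=; apply: eq_bigr => k _.
by rewrite ltnS; case: ifP => //; rewrite mulr0.
Qed.

(** The central binomial C(2d, d) is even for d > 0, being a sum of two equal terms of Pascal's
    triangle. Equivalently, u^(-d-1) with u = z(1 + z) has residue 0 unless d = 0. *)
Lemma bin_diff_diag b d : bin_diff b (b + d) d = (d == 0)%:R.
Proof.
rewrite /bin_diff ltnNge leq_addr addKn /=.
case: d => [|d]; first by rewrite bin0.
by rewrite addSn binSF2 -[in 'C(_, d.+1)]bin_sub ?leq_addl // addnK
           (addF2 (V := ('F_2)^o)).
Qed.

Definition sym_coef (p c : nat) : 'F_2 :=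
  if (c <= p)%N then 'C(c, p - c)%:R else 0.

(** The Adem coefficient binom(s-i-1, t-2i) in the variables s = k - b, i = k - c, N = 3k - s - t,
    where k is the degree of the argument. *)
Definition adem_coef (N b c : nat) : 'F_2 :=
  if (N <= c.*2 + b)%N && (b < c)%N then 'C(c - b.+1, c.*2 + b - N)%:R else 0.

(* Put [u = z (1 + z)]; [sym_coef p c] is the coefficient of [z ^ p] in [u ^ c].
   The symmetry says that [\sum_c Q c u ^ c] is equal to
   [\sum_c Q c (1 + z) ^ c z ^ (N - 2 c)], and [Q b] is the residue in [z] of
   the product of this series by [u ^ (- b - 1)], because [du = dz] modulo 2. *)
Lemma adem_of_symmetry (V : lmodType 'F_2) (Q : nat -> V) (N b : nat) :
    (forall p, (p <= N)%N ->
      \sum_(c < N.+1 | (c.*2 <= N)%N) sym_coef p c *: Q c =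
      \sum_(c < N.+1 | (c.*2 <= N)%N) sym_coef (N - p) c *: Q c) ->
  (3 * b < N)%N ->
  Q b = \sum_(c < N.+1 | (c.*2 <= N)%N) adem_coef N b c *: Q c.
Proof.
move=> symR bN.
(* Since (1 + z)^(-b-1) is the sum of the C(b+k, k) z^k, the value at [f k = b - k] is the residue
   of the series against u^(-b-1). *)
pose S (f : nat -> nat) := \sum_(k < b.+1) 'C(b + k, k)%:R *:
  \sum_(c < N.+1 | (c.*2 <= N)%N) sym_coef (f k) c *: Q c.
have SE f : S f = \sum_(c < N.+1 | (c.*2 <= N)%N)
    (\sum_(k < b.+1) 'C(b + k, k)%:R * sym_coef (f k) c) *: Q c.
  rewrite /S; under eq_bigr do rewrite scaler_sumr.
  rewrite exchange_big /=; apply: eq_bigr => c _.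
  by rewrite scaler_suml; apply: eq_bigr => k _; rewrite scalerA.
have -> : Q b = S (fun k => b - k)%N.
  have bN1 : (b < N.+1)%N by lia.
  rewrite SE (bigD1 (Ordinal bN1)) /=; last by lia.
  rewrite (eq_bigr (fun k : 'I_b.+1 => 'C(b + k, k)%:R *
    (if (k <= 0)%N then 'C(b, 0 - k)%:R else 0))); last first.
    move=> k _; congr (_ * _); rewrite /sym_coef.
    case: k => -[|k] kb /=; first by rewrite subn0 leqnn subnn.
    by rewrite leqNgt ltn_subrL /= (leq_ltn_trans (leq0n k)).
  rewrite bin_convolution_widen // bin_diff0 scale1r big1 ?addr0 // => c.
  rewrite -val_eqE /= => /andP[_ cb].
  (* For c > b the power u^c starts above degree b; for c < b the residue vanishes by
     [bin_diff_diag]. *)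
  have [bc|cltb] := leqP b c.
    rewrite big1 ?scale0r // => k _; rewrite /sym_coef leqNgt.
    by rewrite (_ : b - k < c)%N ?mulr0 //; lia.
  rewrite (eq_bigr (fun k : 'I_b.+1 => 'C(b + k, k)%:R *
    (if (k <= b - c)%N then 'C(c, b - c - k)%:R else 0))); last first.
    move=> k _; congr (_ * _); rewrite /sym_coef.
    have -> : (b - k - c = b - c - k)%N by lia.
    by congr (if _ then _ else _); have := ltn_ord k; lia.
  rewrite bin_convolution_widen ?leq_subr //.
  rewrite -[b in bin_diff _ b](subnKC (ltnW cltb)) bin_diff_diag.
  by rewrite subn_eq0 leqNgt cltb scale0r.
(* The symmetry enters here, in the degrees b - k with k <= b. *)
transitivity (S (fun k => N - (b - k))%N).
  by apply: eq_bigr => k _ /=; rewrite (symR (b - k)%N) //; lia.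
rewrite SE; apply: eq_bigr => c cN; congr (_ *: _); rewrite /adem_coef.
have [Nc|cltN] /= := leqP N (c.*2 + b); last first.
  rewrite big1 // => k _; rewrite /sym_coef.
  by case: ifP => _; rewrite ?(@bin_small _ (_ - _)) ?mulr0 //;
    have := ltn_ord k; lia.
(* From N <= 2c + b and 3b < N; hence the exponent c - b - 1 of 1 + z is nonnegative. *)
have bc : (b < c)%N by lia.
rewrite bc (eq_bigr (fun k : 'I_b.+1 => 'C(b + k, k)%:R *
    (if (k <= c.*2 + b - N)%N then 'C(c, c.*2 + b - N - k)%:R else 0))).
  by rewrite bin_convolution_widen ?/bin_diff ?bc //; lia.
move=> k _; congr (_ * _); rewrite /sym_coef; have kb := ltn_ord k.
rewrite (_ : c <= _)%N; last by lia.
have [kc|kc] := leqP k (c.*2 + b - N); last by rewrite bin_small //; lia.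
by rewrite -bin_sub; [congr ('C(_, _)%:R)|]; lia.
Qed.

(** * Cancellation and reindexing in finite sums *)

Lemma mulF2 (x : 'F_2) : x * x = x.
Proof. by case: x => -[|[|//]] i; apply: val_inj. Qed.

(** The terms at b and n - b cancel in pairs, so only a middle term can survive. *)
Lemma sum_palindrome (V : lmodType 'F_2) (F : nat -> V) n :
  (forall b, (b <= n)%N -> F (n - b)%N = F b) ->
  \sum_(b < n.+1) F b = if odd n then 0 else F n./2.
Proof.
elim/ltn_ind: n F => -[|[|n]] IHn F symF.
- by rewrite big_ord1.
- by rewrite big_ord_recl big_ord1 /= -(symF 1%N) // addF2.
rewrite big_ord_recl big_ord_recr /= addrCA -(symF n.+2) // subnn addF2 addr0.
rewrite (IHn n _ (fun b => F b.+1)) ?negbK // => b bn.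
by rewrite -[RHS]symF; [congr F|]; lia.
Qed.

Lemma sum_even (V : nmodType) (F : nat -> V) n :
  (forall q, odd q -> F q = 0) ->
  \sum_(0 <= q < n.+1) F q = \sum_(c < n.+1 | (c.*2 <= n)%N) F c.*2.
Proof.
move=> F0; rewrite -(big_mkord (fun c => (c.*2 <= n)%N) (fun c => F c.*2)).
transitivity (\sum_(0 <= q < n.+1) \sum_(0 <= c < n.+1 | c.*2 == q) F q).
  apply: eq_big_nat => q qn.
  have [oq|eq] := boolP (odd q).
    by rewrite F0 // big1.
  rewrite (eq_bigl (pred1 q./2)) ?big_nat1_eq; last by move=> c /=; lia.
  by rewrite ifT //; lia.
rewrite (exchange_big_dep_nat xpredT) //= [RHS]big_mkcond.
apply: eq_big_nat => c cn.
under eq_bigl do rewrite eq_sym.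
by rewrite big_nat1_eq.
Qed.

(* Every [b] is [K * d - i] for a unique [i < K] and a unique [d]. *)
Lemma sum_residues (V : nmodType) (F : nat -> V) K n : (0 < K)%N ->
  \sum_(0 <= i < K)
    \sum_(0 <= d < (n + i).+1 | (i <= K * d <= n + i)%N) F (K * d - i)%N =
  \sum_(b < n.+1) F b.
Proof.
move=> K0; rewrite -(big_mkord xpredT).
transitivity (\sum_(0 <= i < K) \sum_(0 <= d < (n + i).+1)
    \sum_(0 <= b < n.+1 | (b + i == K * d)%N) F b).
  apply: eq_bigr => i _; rewrite big_mkcond; apply: eq_bigr => d _.
  case: ifP => id.
    rewrite (eq_bigl (pred1 (K * d - i)%N)) ?big_nat1_eq ?ifT //; first by lia.
    by move=> b /=; apply/eqP/eqP; lia.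
  by rewrite big_nat_cond big1 // => b /andP[bn /eqP bi]; move: id; lia.
transitivity (\sum_(0 <= i < K) \sum_(0 <= b < n.+1)
    \sum_(0 <= d < (n + i).+1 | (b + i == K * d)%N) F b).
  by apply: eq_bigr => i _; rewrite (exchange_big_dep_nat xpredT).
rewrite exchange_big_nat; apply: eq_big_nat => b bn.
(* [d0] is b / K rounded up, and [i0 = K * d0 - b]. *)
pose d0 := ((b + K.-1) %/ K)%N; pose i0 := (K.-1 - (b + K.-1) %% K)%N.
have rK := ltn_pmod (b + K.-1) K0; have dE := divn_eq (b + K.-1) K.
have i0K : (i0 < K)%N by rewrite /i0; lia.
have bE : (b + i0 = K * d0)%N by rewrite mulnC /d0 /i0; lia.
rewrite (eq_big_nat _ _ (F2 := fun i => if i == i0 then F b else 0)).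
  by rewrite -big_mkcond big_nat1_eq i0K.
move=> i iK; rewrite (eq_bigl (fun d => (d == d0) && (i == i0))).
  case: eqP => [->|_]; last by rewrite big_pred0 // => d; rewrite andbF.
  under eq_bigl do rewrite andbT.
  by rewrite big_nat1_eq ifT //; nia.
move=> d; apply/eqP/andP => [bi|[/eqP-> /eqP->]] //.
have d_d0 : d = d0.
  rewrite /d0 (_ : (b + K.-1 = d * K + (K.-1 - i))%N); last by lia.
  by rewrite divnMDl // divn_small ?addn0 //; lia.
by rewrite d_d0 -bE in bi *; split=> //; apply/eqP/(@addnI b).
Qed.

(** * Evaluation in an algebra with zero differential *)

Section Linear.

Variables (U V : lmodType 'F_2) (f : U -> V).
Hypothesis fL : linear f.

Lemma linear_fun0 : f 0 = 0.
Proof. by have := fL (-1) 0 0; rewrite scaler0 addr0 scaleN1r addNr. Qed.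

Lemma linear_funD : {morph f : u v / u + v}.
Proof. by move=> u v; rewrite -[u]scale1r fL !scale1r. Qed.

Lemma linear_funZ (c : 'F_2) u : f (c *: u) = c *: f u.
Proof. by rewrite -[c *: u]addr0 fL linear_fun0 addr0. Qed.

Lemma linear_fun_sum I (r : seq I) (p : pred I) F :
  f (\sum_(i <- r | p i) F i) = \sum_(i <- r | p i) f (F i).
Proof. exact: (big_morph f linear_funD linear_fun0). Qed.

End Linear.

Section Evaluation.

Variables (P : dgOperad) (A : opAlgebra P).

Lemma ev0 n (a : 'I_n -> A) : ev (0 : P n) a = 0.
Proof. exact: (linear_fun0 (ev_linearl a)). Qed.

Lemma evD n (o p : P n) (a : 'I_n -> A) : ev (o + p) a = ev o a + ev p a.
Proof. exact: (linear_funD (ev_linearl a)). Qed.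

Lemma evZ n (c : 'F_2) (o : P n) (a : 'I_n -> A) : ev (c *: o) a = c *: ev o a.
Proof. exact: (linear_funZ (ev_linearl a)). Qed.

Lemma ev_sum n (a : 'I_n -> A) I (r : seq I) (p : pred I) (F : I -> P n) :
  ev (\sum_(i <- r | p i) F i) a = \sum_(i <- r | p i) ev (F i) a.
Proof. exact: (linear_fun_sum (ev_linearl a)). Qed.

Lemma ev2_linearl (o : P 2%N) y : linear (fun x : A => ev2 o x y).
Proof.
have ev2E z : ev2 o z y = ev o (@dfwith _ (fun=> gs_sort A) (args2 0 y) ord0 z).
  congr ev; apply: functional_extensionality_dep => i; case: dfwithP => // j.
  by rewrite /args2 eq_sym => /negPf ->.
by move=> c u v; rewrite !ev2E; exact: ev_linearr.
Qed.

Lemma ev2_linearr (o : P 2%N) x : linear (fun y : A => ev2 o x y).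
Proof.
have ev2E z :
    ev2 o x z = ev o (@dfwith _ (fun=> gs_sort A) (args2 x 0) ord_max z).
  congr ev; apply: functional_extensionality_dep => i; case: dfwithP => // j.
  by rewrite /args2; case: j => -[|[]].
by move=> c u v; rewrite !ev2E; exact: ev_linearr.
Qed.

Lemma ev2_homog (o : P 2%N) (c k l : int) (x y : A) :
  homog c o -> homog k x -> homog l y -> homog (c + k + l) (ev2 o x y).
Proof.
move=> oc xk yl.
have := ev_homog (a := args2 x y) (l := args2 k l) oc.
rewrite big_ord_recl big_ord1 addrA; apply.
by rewrite /args2 => i; case: ifP.
Qed.

Lemma ev_castar m n (E : m = n) (o : P m) (a : 'I_n -> A) :
  ev (castar E o) a = ev o (a \o cast_ord E).
Proof.
case: n / E a => a; congr ev; apply: functional_extensionality_dep => i /=.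
by rewrite cast_ord_id.
Qed.

Lemma ev_comp2 (o p q : P 2%N) (a : 'I_4 -> A) :
  ev (comp2 o p q) a = ev2 o (ev2 p (a 0) (a 1)) (ev2 q (a 2) (a 3)).
Proof.
rewrite ev_castar ev_comp; congr ev; apply: functional_extensionality_dep => i.
have block (k l : 'I_2) (j : 'I_4) : (k * 2 + l)%N = j ->
    a (cast_ord sum22 (@tagnat.Rank 2 (fun=> 2%N) k l)) = a j.
  move=> jE; congr a; apply: val_inj.
  transitivity (@tagnat.Rank 2 (fun=> 2%N) k l : nat); first by [].
  rewrite tagnat.RankEsum -[RHS]jE; congr (_ + _)%N.
  by rewrite big_mkcond !big_ord_recl big_ord0; case: k {jE} => -[|[]].
rewrite {2}/args2; case: i => -[|[]] //= ?; congr ev;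
  apply: functional_extensionality_dep => j; rewrite /args2;
  by case: j => -[|[]] //= ?; apply: block.
Qed.

Hypothesis dA0 : forall x : A, dalg x = 0.

Lemma ev_dop n (o : P n) (a : 'I_n -> A) : ev (dop o) a = 0.
Proof.
have := ev_d o a; rewrite dA0 big1 ?addr0 // => i _; rewrite dA0.
exact: (linear_fun0 (ev_linearr o a i)).
Qed.

Lemma ev_act_id_plus n (o : P n) (s : 'S_n) (a : 'I_n -> A) :
  ev (act_id_plus o s) a = ev o a + ev o (a \o (s^-1)%g).
Proof. by rewrite evD ev_act. Qed.

End Evaluation.

(** Once every e_i is symmetric on the algebra, the two summands in the bracket of [u^m_n]_x act
    alike; this adds their coefficients, by Pascal's rule. *)
Lemma multi_pred (i m : nat) :
  multi i m.+1%:Z + multi (i%:Z - 1) m.+1%:Z = 'C(i + m, m)%:R.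
Proof.
case: i => [|i]; first by rewrite /multi /= addr0 bin0 add0n binn.
have -> : i.+1%:Z - 1 = i by lia.
rewrite /multi !lez_nat !leq0n /= addSn binS addnS -addSn natrD -addrA.
by rewrite (addF2 (V := ('F_2)^o)) addr0 -bin_sub ?leq_addr // addKn.
Qed.

Lemma multi_sub (n m i : nat) : (0 < n + i)%N ->
  multi (n%:Z - m.+1%:Z + i%:Z) (m.+1%:Z - 1) = 'C((n + i).-1, m)%:R.
Proof.
move=> ni; have -> : m.+1%:Z - 1 = m by lia.
have [mni|nim] := leqP m (n + i).-1; last first.
  by rewrite bin_small // /multi ifF //; apply/negbTE; lia.
have -> : n%:Z - m.+1%:Z + i%:Z = ((n + i).-1 - m)%N by lia.
by rewrite /multi !lez_nat !leq0n /= subnK // bin_sub.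
Qed.

(** * Action of the cup elements and of the relations d G^m_n *)

Section AdemCartan.

Variables (P : dgOperad) (e : nat -> P 2%N) (G : nat -> nat -> P 4%N).
Hypothesis levP : isLevAC e G.
Variable A : opAlgebra P.
Hypothesis dA0 : forall x : A, dalg x = 0.

Local Notation E i x y := (ev2 (ez e i) x y).

Lemma ez_neg (i : int) : i < 0 -> ez e i = 0.
Proof. by case: i. Qed.

Lemma ev2_ezN (i : int) (x y : A) : i < 0 -> E i x y = 0.
Proof. by move=> i0; rewrite ez_neg // /ev2 ev0. Qed.

Lemma ev2_act_s21 (o : P 2%N) (x y : A) : ev2 (opact o s21) x y = ev2 o y x.
Proof.
rewrite /ev2 ev_act tpermV; congr ev; apply: functional_extensionality_dep => i.
rewrite /args2; case: tpermP => [->|->|] //.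
by case: i => -[|[|//]] lti i0 i1; [case: i0 | case: i1]; apply: val_inj.
Qed.

Lemma ev2_ezC (i : int) (x y : A) : E i x y = E i y x.
Proof.
case: i => [i|i]; last by rewrite !ev2_ezN.
apply: addF2_eq0; rewrite -(ev2_act_s21 _ x y).
have := ev_dop dA0 (e i.+1) (args2 x y).
by rewrite (lev_de levP) evD (_ : i.+1%:Z - 1 = i) //; lia.
Qed.

Lemma ev2_ez_act (i : int) k (x y : A) :
  ev2 (opact (ez e i) (s21 ^+ k)%g) x y = E i x y.
Proof.
elim: k x y => [|k IHk] x y; first by rewrite expg0 act_1.
by rewrite expgS -act_M ev2_act_s21 IHk ev2_ezC.
Qed.

Lemma ev_uterm (m n : nat) (x : int) (a : 'I_4 -> A) :
  ev (uterm e m.+1 n x) a = \sum_(b < n.+1)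
    (bin_pred b m * bin_pred (n - b) m) *:
      E x (E b%:Z (a 0) (a 1)) (E (n - b)%N%:Z (a 2) (a 3)).
Proof.
case: n => [|n].
  (* The convention [bin_pred 0 m = 1] makes the formula agree with the separate definition of
     [u^m_0]_x. *)
  by rewrite big_ord1 /= ev_comp2 ev2_ez_act mulr1 scale1r.
set K := (2 ^ (trunc_log 2 m.+1).+1)%N.
have mK : (m < K)%N by rewrite ltnW // trunc_log_ltn.
pose F b := (bin_pred b m * bin_pred (n.+1 - b) m) *:
      E x (E b%:Z (a 0) (a 1)) (E (n.+1 - b)%N%:Z (a 2) (a 3)).
rewrite -[RHS](sum_residues F n.+1 (leq_ltn_trans (leq0n m) mK)).
rewrite ev_sum; apply: eq_bigr => i _; rewrite ev_sum; apply: eq_bigr => d.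
move=> /andP[iKd Kdn].
rewrite evZ evD !evZ !ev_comp2 !ev2_ez_act ev2_act_s21.
rewrite (ev2_ezC (n.+1 + i - K * d)%N (a 3)) -scalerDl scalerA.
rewrite multi_pred multi_sub //.
rewrite /F mulrC.
have -> : (n.+1 - (K * d - i) = n.+1 + i - K * d)%N by lia.
(* With b = K d - i the coefficients are C(K d - b + m, m) and C(K d + (n+1-b) - 1, m). As m < K and
   K is a power of 2, the multiple of K drops out modulo 2. *)
congr (_ * _ *: _).
  by rewrite -(bin_pow2_opp (d := d) mK) ?leq_subr // subKn.
by rewrite -(bin_pow2_pred (d := d) mK) ?subnKC //; lia.
Qed.

Lemma ev_uterm_diag (m n : nat) (x : int) (a : 'I_4 -> A) (F : nat -> A) :
    (forall b : nat, E b (a 0) (a 1) = F b) ->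
    (forall b : nat, E b (a 2) (a 3) = F b) ->
  ev (uterm e m.+1 n x) a =
  if odd n then 0 else bin_pred n./2 m *: E x (F n./2) (F n./2).
Proof.
move=> F01 F23; rewrite ev_uterm.
pose H b := (bin_pred b m * bin_pred (n - b) m) *: E x (F b) (F (n - b)%N).
rewrite (eq_bigr (fun b : 'I_n.+1 => H b)) => [|b _]; last by rewrite F01 F23.
(* Both halves of [a] give the same [F], so commutativity of the outer operation exchanges b and n -
   b. *)
rewrite sum_palindrome => [|b bn]; last first.
  by rewrite /H subKn // mulrC ev2_ezC.
case: ifP => // /negbT even_n.
by rewrite /H (_ : n - n./2 = n./2)%N ?mulF2 //; lia.
Qed.

Lemma arg_s3412V (a : 'I_4 -> A) : let b i := a ((s3412^-1)%g i) in
  [/\ b 0 = a 2, b 1 = a 3, b 2 = a 0 & b 3 = a 1].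
Proof.
by split; rewrite /=; congr a; apply: (canLR (permK _)); apply: val_inj;
   rewrite !permE /= !permE.
Qed.

Lemma ev_alpha (N p : nat) (a : 'I_4 -> A) (F : nat -> A) : (p <= N)%N ->
    (forall b : nat, E b (a 0) (a 1) = F b) ->
    (forall b : nat, E b (a 2) (a 3) = F b) ->
  ev (alpha e N p) a =
  \sum_(c < N.+1 | (c.*2 <= N)%N)
    sym_coef p c *: E (N - c.*2)%N%:Z (F c) (F c).
Proof.
move=> pN F01 F23.
pose H q := if odd q then 0 else E (N - q)%N%:Z (F q./2) (F q./2).
have uptoE : upto (N%:Z - p%:Z) = (N - p).+1 by rewrite /upto; case: ifP; lia.
have uptoE1 : upto (N%:Z - p%:Z - 1) = (N - p)%N.
  by rewrite /upto; case: ifP; lia.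
rewrite evD uptoE uptoE1 !ev_sum.
rewrite (eq_big_nat _ _ (F2 := fun s => bin_pred (s + p)./2 s *: H (s + p)%N));
  last first.
  move=> s sN; rewrite -PoszD (ev_uterm_diag _ _ _ F01 F23) /H.
  case: ifP => _; first by rewrite scaler0.
  by congr (_ *: ev2 (ez e _) _ _); lia.
rewrite (eq_big_nat _ _ (m := 0%N) (n := (N - p)%N)
  (F2 := fun s => bin_pred (s.+1 + p)./2 s *: H (s.+1 + p)%N)); last first.
  move=> s sN; have -> : s%:Z + p + 1 = (s.+1 + p)%N by lia.
  have [a0 a1 a2 a3] := arg_s3412V a.
  (* The permutation (3412) swaps the two halves of the arguments, which both give [F]. *)
  rewrite ev_act (ev_uterm_diag (a := fun i => a ((s3412^-1)%g i)) _ _ _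
    (F := F)) ?a0 ?a1 ?a2 ?a3 // /H.
  case: ifP => _; first by rewrite scaler0.
  by congr (_ *: ev2 (ez e _) _ _); lia.
(* Term s + 1 of the first sum and term s of the second involve the same [H (s.+1 + p)]; their
   coefficients add up to an ordinary binomial. *)
rewrite big_nat_recl // -addrA -big_split /=.
rewrite (eq_bigr (fun s => 'C((s.+1 + p)./2, s.+1)%:R *: H (s.+1 + p)%N));
  last by move=> s _; rewrite -scalerDl bin_predS.
have -> : bin_pred (0 + p)./2 0 = 'C((0 + p)./2, 0)%:R.
  by rewrite bin_pred0 bin0.
rewrite -(big_nat_recl _ _ (fun s => 'C((s + p)./2, s)%:R *: H (s + p)%N)) //.
pose H' q := if (p <= q)%N then 'C(q./2, q - p)%:R *: H q else 0.
rewrite (eq_bigr (fun s => H' (s + p)%N)) => [|s _]; last first.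
  by rewrite /H' leq_addl addnK.
transitivity (\sum_(0 <= q < N.+1) H' q).
  rewrite [RHS](big_cat_nat (n := p)) ?leqW //= [X in _ = X + _]big_nat.
  rewrite [X in _ = X + _]big1.
    by rewrite add0r -[in RHS](add0n p) big_addn subSn.
  by move=> q /andP[_ qp]; rewrite /H' leqNgt qp.
(* Only q = 2c remains, with coefficient C(c, 2c - p) = C(c, p - c). *)
rewrite sum_even => [|q oq]; last by rewrite /H' /H oq scaler0 if_same.
apply: eq_bigr => c cN; rewrite /H' /H odd_double doubleK /sym_coef.
have [pc|cp] := leqP p c.*2.
  have [cp|pc'] := leqP c p; last by rewrite bin_small //; lia.
  by rewrite -bin_sub; [congr ('C(_, _)%:R *: _) |]; lia.
by rewrite ifT ?bin_small ?scale0r //; lia.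
Qed.

(** In d G^m_n the terms containing a generator act by zero, either because the arguments are
    invariant or, for n = 1 or m = 1, because the generator in question is itself zero. The two
    [alpha] terms must then agree. *)
Lemma ev_relation (m n : nat) (a : 'I_4 -> A) : (0 < m <= n)%N ->
    n = 1%N \/ a \o (s2143^-1)%g = a -> m = 1%N \/ a \o (s4321^-1)%g = a ->
  ev (alpha e n.-1%:Z (n.-1 - m.-1./2)%N) a =
  ev (alpha e n.-1%:Z m.-1./2) (a \o (s3214^-1)%g).
Proof.
move=> mn inv2143 inv4321; case/andP: (mn) => m0 le_mn.
have act0 k (s : 'S_k) : opact (0 : P k) s = 0.
  exact: (linear_fun0 (@act_linear P k s)).
have ev2143 X : (n = 1%N -> X = 0) -> ev (act_id_plus X s2143) a = 0.
  by case: inv2143 => [-> /(_ erefl)->|inv _];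
     rewrite ev_act_id_plus ?ev0 ?addr0 // inv addF2.
have ev4321 k : ev (act_id_plus (G (m - 2) k) s4321) a = 0.
  case: inv4321 => [->|inv]; last by rewrite ev_act_id_plus inv addF2.
  by rewrite (lev_G0 levP) // ev_act_id_plus !ev0 addr0.
have n1 : n%:Z - 1 = n.-1 by lia.
have n1p : n.-1%:Z - m.-1./2%:Z = (n.-1 - m.-1./2)%N by lia.
apply: addF2_eq0; have [mltn|mEn] : (m < n \/ m = n)%N by lia.
  have := ev_dop dA0 (G m n) a.
  rewrite (lev_dG levP) ?m0 // n1 n1p 3!evD ev_act ev4321 ev2143 ?add0r //.
  by move=> n_1; lia.
subst n; have := ev_dop dA0 (G m m) a.
rewrite (lev_dG_diag levP) // n1 n1p 3!evD ev_act ev4321 ev2143 ?add0r //.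
by move=> ->; rewrite (lev_G0 levP) // act0.
Qed.

Definition args4 (x y z t : A) : 'I_4 -> A := fun i => nth x [:: x; y; z; t] i.

Lemma args4E (a : 'I_4 -> A) x y z t :
  a 0 = x -> a 1 = y -> a 2 = z -> a 3 = t -> a = args4 x y z t.
Proof.
move=> <- <- <- <-; apply: functional_extensionality_dep.
by case=> -[|[|[|[|]]]] //= i; congr a; apply: val_inj.
Qed.

Lemma args4_s2143 x y z t : args4 x y z t \o (s2143^-1)%g = args4 y x t z.
Proof.
by apply: args4E; rewrite /= invMg !tpermV permM !permE.
Qed.

Lemma args4_s3214 x y z t : args4 x y z t \o (s3214^-1)%g = args4 z y x t.
Proof.
by apply: args4E; rewrite /= tpermV permE.
Qed.

Lemma ev_alpha_top (n : nat) (a : 'I_4 -> A) :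
  ev (alpha e n n) a =
  \sum_(j < n.+1) E 0 (E j (a 0) (a 1)) (E (n - j)%N%:Z (a 2) (a 3)).
Proof.
have u0 : n%:Z - 0%:Z - n%:Z = 0 by rewrite subr0 subrr.
rewrite /alpha subrr big_nat1 big_geq // addr0 u0 add0r ev_uterm.
by apply: eq_bigr => j _; rewrite !bin_pred0 mulr1 scale1r.
Qed.

Lemma ev_level (x y z t : A) :
  E 0 (E 0 x y) (E 0 z t) = E 0 (E 0 x z) (E 0 y t).
Proof.
(* (3214) turns the arguments y, x, z, t into z, x, y, t, which is the interchange up to
   commutativity. *)
have := @ev_relation 1 1 (args4 y x z t) isT (or_introl erefl)
  (or_introl erefl).
rewrite args4_s3214 !(ev_alpha_top 0) !big_ord1.
by rewrite (ev2_ezC 0 x y) (ev2_ezC 0 x z).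
Qed.

Lemma ev_cartan (n : nat) (x y : A) :
  E n (E 0 x y) (E 0 x y) = \sum_(j < n.+1) E 0 (E j x x) (E (n - j)%N%:Z y y).
Proof.
case: n => [|n]; first by rewrite big_ord1 ev_level.
have := @ev_relation 1 n.+2 (args4 x x y y) isT.
rewrite args4_s2143 args4_s3214 => /(_ (or_intror erefl) (or_introl erefl)).
rewrite (ev_alpha_top n.+1) => ->.
(* (3214) turns x, x, y, y into y, x, x, y, whose halves give equal values by symmetry of the e_b.
   For p = 0 only c = 0 contributes. *)
rewrite (@ev_alpha n.+1 0 (args4 y x x y) (fun b : nat => E b x y)) //;
  last by move=> b; exact: ev2_ezC.
rewrite (bigD1 ord0) //= scale1r subn0 big1 ?addr0 // => c.
by case: c => -[|c] //= _ _; rewrite /sym_coef scale0r.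
Qed.

Lemma ev_adem_symmetry (N p : nat) (x : A) : (p <= N)%N ->
  let Q (c : nat) := E (N - c.*2)%N%:Z (E c x x) (E c x x) in
  \sum_(c < N.+1 | (c.*2 <= N)%N) sym_coef p c *: Q c =
  \sum_(c < N.+1 | (c.*2 <= N)%N) sym_coef (N - p) c *: Q c.
Proof.
(* The claim is symmetric in p and N - p. The bound 2p <= N ensures m <= n for m = 2p + 1 and n = N
   + 1, and this m yields the index p in d G^m_n. *)
move=> pN Q; wlog p2N : p pN / (p.*2 <= N)%N.
  have [p2N|Np2] := leqP p.*2 N; first by apply.
  by move/(_ (N - p)%N) => -> //; rewrite ?subKn //; lia.
pose a : 'I_4 -> A := fun=> x.
have := @ev_relation p.*2.+1 N.+1 a p2N (or_intror erefl) (or_intror erefl).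
rewrite /= doubleK.
by rewrite !(@ev_alpha _ _ _ (fun b : nat => E b x x)) ?leq_subr.
Qed.

Lemma ev_adem (N b : nat) (x : A) : (3 * b < N)%N ->
  let Q (c : nat) := E (N - c.*2)%N%:Z (E c x x) (E c x x) in
  Q b = \sum_(c < N.+1 | (c.*2 <= N)%N) adem_coef N b c *: Q c.
Proof.
by move=> bN Q; apply: adem_of_symmetry bN => p pN; exact: ev_adem_symmetry.
Qed.

End AdemCartan.

(** * Steenrod operations *)

Lemma fsum_seq (V : nmodType) (I : choiceType) (s : seq I) (F : I -> V) :
    uniq s -> (forall i, F i != 0 -> i \in s) ->
  \sum_(i \in [set: I]%classic) F i = \sum_(i <- s) F i.
Proof.
move=> us Fs; rewrite (fsbigE s) //; last first.
  by move=> i _; apply: contraNeq => /Fs.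
by apply: eq_bigl => i; rewrite mem_set.
Qed.

Lemma eq_sum_supp (V : nmodType) (I : choiceType) (r s : seq I) (F : I -> V) :
    uniq r -> uniq s -> (forall i, F i != 0 -> (i \in r) && (i \in s)) ->
  \sum_(i <- r) F i = \sum_(i <- s) F i.
Proof. by move=> ur us F0; rewrite -!fsum_seq // => i /F0/andP[]. Qed.

Section Graded.

Variable V : gradedSpace.

Lemma homog0 k : homog k (0 : V).
Proof. exact: (linear_fun0 (gs_proj_linear k)). Qed.

Lemma homogD k (u v : V) : homog k u -> homog k v -> homog k (u + v).
Proof.
by move=> ku kv; rewrite /homog (linear_funD (gs_proj_linear k)) ku kv.
Qed.

Lemma homog_proj k (v : V) : homog k (gs_proj k v).
Proof. by rewrite /homog gs_projK eqxx. Qed.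

Lemma proj_homog k l (v : V) :
  homog k v -> gs_proj l v = if l == k then v else 0.
Proof. by move=> <-; rewrite gs_projK. Qed.

Lemma gs_proj_support (v : V) :
  exists2 s : seq int, uniq s & forall k, k \notin s -> gs_proj k v = 0.
Proof.
have [s us vE] := gs_proj_sum v; exists s => // k ks.
rewrite vE (linear_fun_sum (gs_proj_linear k)) big_seq big1 // => l ls.
by rewrite gs_projK; case: eqP => // kl; rewrite kl ls in ks.
Qed.

Lemma linear_ext_homog (W : lmodType 'F_2) (f g : V -> W) :
  linear f -> linear g -> (forall k v, homog k v -> f v = g v) -> f =1 g.
Proof.
move=> fL gL fg v; have [s _ ->] := gs_proj_sum v.
rewrite (linear_fun_sum fL) (linear_fun_sum gL).
by apply: eq_bigr => k _; apply: fg (homog_proj k v).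
Qed.

End Graded.

Section SteenrodAction.

Variables (P : dgOperad) (e : nat -> P 2%N) (G : nat -> nat -> P 4%N).
Hypothesis levP : isLevAC e G.
Variable A : opAlgebra P.
Hypothesis dA0 : forall x : A, dalg x = 0.

Local Notation E i x y := (ev2 (ez e i) x y).

(** The index k - r depends on the degree, so an inhomogeneous vector is treated component by
    component. *)
Definition steenrod (r : int) (x : A) : A :=
  \sum_(k \in [set: int]%classic) E (k - r) (gs_proj k x) (gs_proj k x).

Lemma ev2_0l (o : P 2%N) (x : A) : ev2 o 0 x = 0.
Proof. exact: (linear_fun0 (ev2_linearl o x)). Qed.

Lemma steenrod_seq r (x : A) (s : seq int) :
    uniq s -> (forall k, k \notin s -> gs_proj k x = 0) ->
  steenrod r x = \sum_(k <- s) E (k - r) (gs_proj k x) (gs_proj k x).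
Proof.
move=> us xs; apply: fsum_seq => // k; apply: contraNT => /xs ->.
by rewrite ev2_0l.
Qed.

Lemma steenrod_homog k r (x : A) : homog k x -> steenrod r x = E (k - r) x x.
Proof.
move=> kx; rewrite (@steenrod_seq r x [:: k]) ?big_seq1 ?kx // => l.
by rewrite inE (proj_homog l kx) => /negPf ->.
Qed.

Lemma steenrod_linear r : linear (steenrod r).
Proof.
have sD : {morph steenrod r : x y / x + y}.
  move=> x y; have [s us xs] := gs_proj_support x.
  have [t ut yt] := gs_proj_support y.
  have xst k : k \notin undup (s ++ t) -> gs_proj k x = 0.
    by rewrite mem_undup mem_cat negb_or => /andP[/xs].
  have yst k : k \notin undup (s ++ t) -> gs_proj k y = 0.
    by rewrite mem_undup mem_cat negb_or => /andP[_ /yt].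
  have projD k := linear_funD (gs_proj_linear k) x y.
  rewrite !(@steenrod_seq r _ (undup (s ++ t))) ?undup_uniq //; last first.
    by move=> k kst; rewrite projD xst ?yst ?addr0.
  rewrite -big_split; apply: eq_bigr => k _ /=; rewrite projD.
  set u := gs_proj k x; set v := gs_proj k y.
  rewrite (linear_funD (ev2_linearl _ _)) !(linear_funD (ev2_linearr _ _)).
  (* The cross terms in (u, v) and (v, u) are equal, hence cancel. *)
  by rewrite (ev2_ezC levP dA0 _ v u) addrA -[X in X + _]addrA addF2 addr0.
have s0 : steenrod r 0 = 0.
  by rewrite (steenrod_homog r (homog0 _ 0)) ev2_0l.
move=> c x y; rewrite sD; congr (_ + _).
(* The operation is quadratic, but the only scalars are 0 and 1. *)
case: c => -[|[|//]] c.
  by rewrite (_ : Ordinal c = 0) ?scale0r //; apply: val_inj.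
by rewrite (_ : Ordinal c = 1) ?scale1r //; apply: val_inj.
Qed.

Lemma homog_steenrod k r (x : A) : homog k x -> homog (k + r) (steenrod r x).
Proof.
move=> kx; rewrite (steenrod_homog r kx).
have [kr|rk] := ltP (k - r) 0; first by rewrite ev2_ezN //; exact: homog0.
have -> : k + r = - (absz (k - r)%R)%:Z + k + k by lia.
apply: (ev2_homog _ kx kx); rewrite /ez rk; exact: (lev_e_homog levP).
Qed.

Lemma steenrod_unstable k n (x : A) : homog k x -> k < n -> steenrod n x = 0.
Proof. by move=> kx kn; rewrite (steenrod_homog n kx) ev2_ezN //; lia. Qed.

Lemma steenrod_adem (t s k : int) (r : seq int) (x : A) :
    t < 2 * s -> uniq r ->
    (forall i : int, zbin (s - i - 1) (t - 2 * i) != 0%N -> i \in r) ->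
    homog k x ->
  steenrod t (steenrod s x) =
  \sum_(i <- r) (zbin (s - i - 1) (t - 2 * i))%:R *:
    steenrod (s + t - i) (steenrod i x).
Proof.
move=> ts ur rP kx.
(* The value of Sq^(s+t-i) Sq^i on x: the outer index is (k + i) - (s + t - i). *)
pose T (i : int) := E (k + 2 * i - s - t) (E (k - i) x x) (E (k - i) x x).
have steenrodE (i j : int) : i + j = s + t -> steenrod i (steenrod j x) = T j.
  move=> ij; rewrite (steenrod_homog i (homog_steenrod j kx)).
  by rewrite (steenrod_homog j kx) /T; congr (ev2 (ez e _) _ _); lia.
rewrite steenrodE ?[t + s]addrC //.
under eq_bigr do rewrite steenrodE ?subrK //.
have T0 (i : int) : T i != 0 -> 0 <= k - i /\ 0 <= k + 2 * i - s - t.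
  move=> Ti; split; rewrite leNgt; apply: contraNN Ti => ?; rewrite /T.
    by rewrite (@ev2_ezN _ _ _ (k - i)) // (linear_fun0 (ev2_linearl _ _)).
  by rewrite ev2_ezN.
have [ks|sk] := ltP k s.
  have -> : T s = 0 by rewrite /T (@ev2_ezN _ _ _ (k - s)) ?ev2_0l //; lia.
  (* A nonzero [T i] requires s + t - 2i <= k < s, so t - 2i < 0 and the binomial vanishes. *)
  rewrite big1 // => i _; have [->|/T0[ki kist]] := eqVneq (T i) 0.
    by rewrite scaler0.
  by rewrite /zbin ifF ?scale0r //; apply/negbTE; lia.
(* Under these substitutions t < 2s becomes 3b < N, and i = k - c turns [T i] into the term with
   index c of [ev_adem]. *)
pose b := absz (k - s)%R; pose N := absz (3 * k - s - t)%R.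
have bN : (3 * b < N)%N by rewrite /b /N; lia.
have bE : s = k - b%:Z by rewrite /b; lia.
have NE : t = 3 * k - s - N%:Z by rewrite /N; lia.
have TE (c : nat) : (c.*2 <= N)%N ->
    T (k - c%:Z) = E (N - c.*2)%N%:Z (E c x x) (E c x x).
  move=> cN; rewrite /T (_ : k - (k - c%:Z) = c); last by lia.
  by congr (ev2 (ez e _) _ _); lia.
rewrite bE TE; last by lia.
rewrite (ev_adem levP dA0 x bN).
pose cs := [seq c <- iota 0 N.+1 | (c.*2 <= N)%N].
transitivity (\sum_(i <- [seq k - c%:Z | c <- cs])
    (zbin (s - i - 1) (t - 2 * i))%:R *: T i); last first.
  rewrite bE; apply: eq_sum_supp => //.
    by rewrite map_inj_uniq ?filter_uniq ?iota_uniq // => c d; lia.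
  move=> i Fi; apply/andP; split.
    apply/mapP; exists (absz (k - i)%R).
      have /T0[] : T i != 0 by apply: contraNneq Fi => ->; rewrite scaler0.
      by rewrite mem_filter mem_iota; lia.
    have /T0[] : T i != 0 by apply: contraNneq Fi => ->; rewrite scaler0.
    by lia.
  by rewrite -bE in Fi; apply: rP; apply: contraNneq Fi => ->; rewrite scale0r.
rewrite big_map big_filter -[iota 0 N.+1]/(index_iota 0 N.+1) big_mkord.
apply: eq_bigr => c cN; rewrite TE //; congr (_ *: _).
rewrite /adem_coef /zbin.
have [Nc|cN'] := leqP N (c.*2 + b); last by rewrite ifF //; apply/negbTE; lia.
have [bc|cb] := ltnP b c; last by rewrite ifF //; apply/negbTE; lia.
have -> : s - (k - c%:Z) - 1 = (c - b.+1)%N by lia.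
have -> : t - 2 * (k - c%:Z) = (c.*2 + b - N)%N by lia.
by rewrite !lez_nat leq0n /=; case: ifP => // ?; rewrite bin_small //; lia.
Qed.

Lemma steenrod_cartan (k l s : int) (x y : A) : homog k x -> homog l y ->
  steenrod s (E 0 x y) =
  \sum_(t \in [set: int]%classic) E 0 (steenrod t x) (steenrod (s - t) y).
Proof.
move=> kx ly; have klxy : homog (k + l) (E 0 x y).
  by rewrite -[k]add0r; apply: ev2_homog kx ly; exact: (lev_e_homog levP 0).
rewrite (steenrod_homog s klxy).
pose F (t : int) := E 0 (E (k - t) x x) (E (l - (s - t)) y y).
transitivity (\sum_(t \in [set: int]%classic) F t); last first.
  apply: eq_fsbigr => t _.
  by rewrite (steenrod_homog _ kx) (steenrod_homog _ ly).
have F0 (t : int) : F t != 0 -> 0 <= k - t /\ 0 <= l - (s - t).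
  move=> Ft; split; rewrite leNgt; apply: contraNN Ft => ?; rewrite /F.
    by rewrite (@ev2_ezN _ _ _ (k - t)) // ev2_0l.
  by rewrite (@ev2_ezN _ _ _ (l - _)) // (linear_fun0 (ev2_linearr _ _)).
(* The inner indices k - t and l - (s - t) add up to k + l - s; if this is negative, one of them is,
   and both sides vanish. *)
have [n0|n0] := ltP (k + l - s) 0.
  rewrite ev2_ezN // fsbig1 // => t _; apply/eqP; apply: contraTT isT => /F0.
  lia.
pose n := absz (k + l - s)%R; have nE : k + l - s = n by rewrite /n; lia.
rewrite nE (ev_cartan levP dA0).
(* The substitution is t = k - j, where j is the inner index on x. *)
rewrite (@fsum_seq _ _ [seq k - j%:Z | j <- iota 0 n.+1]).
- rewrite big_map -[iota 0 n.+1]/(index_iota 0 n.+1) big_mkord.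
  apply: eq_bigr => j _; rewrite /F; have := ltn_ord j => jn.
  by congr (ev2 _ (ev2 (ez e _) _ _) (ev2 (ez e _) _ _)); lia.
- by rewrite map_inj_uniq ?iota_uniq // => i j; lia.
- move=> t /F0[kt lst]; apply/mapP; exists (absz (k - t)%R); last by lia.
  by rewrite mem_iota; lia.
Qed.

(** * The action of the extended Steenrod algebra *)

Fixpoint b2pre_act (b : b2pre) (x : A) : A :=
  match b with
  | b2zero => 0
  | b2one => x
  | b2sq r => steenrod r x
  | b2add b c => b2pre_act b x + b2pre_act c x
  | b2mul b c => b2pre_act b (b2pre_act c x)
  | b2scale c b => c *: b2pre_act b x
  end.

Lemma b2pre_act_linear b : linear (b2pre_act b).
Proof.
elim: b => [||r|b IHb c IHc|b IHb c IHc|c b IHb] a x y /=.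
- by rewrite scaler0 addr0.
- by [].
- exact: steenrod_linear.
- by rewrite IHb IHc scalerDr addrACA.
- by rewrite IHc IHb.
- by rewrite IHb scalerDr !scalerA mulrC.
Qed.

Lemma b2pre_act_foldr (c : int -> 'F_2) (f : int -> b2pre) r x :
  b2pre_act (foldr (fun i => b2add (b2scale (c i) (f i))) b2zero r) x =
  \sum_(i <- r) c i *: b2pre_act (f i) x.
Proof. by elim: r => [|i r IHr]; rewrite ?big_nil ?big_cons //= IHr. Qed.

Lemma b2pre_act_eq b c : b2eq b c -> b2pre_act b =1 b2pre_act c.
Proof.
elim=> {b c} //=.
- by move=> x y _ xy v; rewrite xy.
- by move=> x y z _ xy _ yz v; rewrite xy.
- by move=> x x' y y' _ xx' _ yy' v; rewrite xx' yy'.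
- by move=> x x' y y' _ xx' _ yy' v; rewrite xx' yy'.
- by move=> c x x' _ xx' v; rewrite xx'.
- by move=> x y z v; rewrite addrA.
- by move=> x y v; rewrite addrC.
- by move=> x v; rewrite add0r.
- by move=> x y z v; rewrite (linear_funD (b2pre_act_linear x)).
- by move=> c d x v; rewrite scalerA.
- by move=> x v; rewrite scale0r.
- by move=> x v; rewrite scale1r.
- by move=> c x y v; rewrite scalerDr.
- by move=> c d x v; rewrite scalerDl.
- by move=> c x y v; rewrite (linear_funZ (b2pre_act_linear x)).
(* Both sides of an Adem relation act linearly, so homogeneous vectors suffice. *)
move=> t s r ts ur rP; apply: linear_ext_homog.
- exact: (b2pre_act_linear (b2mul (b2sq t) (b2sq s))).
- exact: b2pre_act_linear.
- by move=> k v kv; rewrite b2pre_act_foldr /= (steenrod_adem ts ur rP kv).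
Qed.

Definition b2_act (b : B2) : A -> A := b2pre_act (repr b).

Lemma b2_act_pi b : b2_act (\pi_B2 b) =1 b2pre_act b.
Proof. exact: b2pre_act_eq (b2_reprK b). Qed.

Lemma b2_act_linearl x : linear (b2_act^~ x).
Proof.
move=> c; elim/B2ind=> b; elim/B2ind=> d.
have -> : c *: \pi_B2 b + \pi_B2 d = \pi_B2 (b2add (b2scale c b) d).
  by rewrite -B2addE -B2scaleE.
by rewrite !b2_act_pi.
Qed.

Lemma b2_actM b c x : b2_act (b * c) x = b2_act b (b2_act c x).
Proof.
elim/B2ind: b => b; elim/B2ind: c => c.
by rewrite -[_ * _]/(B2mul _ _) B2mulE !b2_act_pi.
Qed.

Lemma b2_act_graded : isGradedB2Module b2_act.
Proof.
split.
- exact: b2_act_linearl.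
- by move=> b; exact: b2pre_act_linear.
- exact: b2_act_pi b2one.
- exact: b2_actM.
move=> k l b x [ws /allP wsk ->] lx.
rewrite (linear_fun_sum (b2_act_linearl x)) big_seq.
(* It remains to treat one monomial, by induction on its length. *)
elim/big_ind: _ => [||w /wsk/eqP <-]; [exact: homog0 | exact: homogD |].
elim: w => [|i w IHw]; first by rewrite !big_nil add0r; rewrite b2_act_pi.
rewrite !big_cons b2_actM b2_act_pi /= -addrA addrC.
exact: homog_steenrod.
Qed.

Lemma level_graded :
  @isGradedLevelAlgebra A (fun x y => ev2 (e 0%N) x y).
Proof.
split.
- by move=> y; exact: ev2_linearl.
- by move=> x; exact: ev2_linearr.
- move=> k l x y kx ly; rewrite -[k]add0r.
  by apply: ev2_homog kx ly; exact: (lev_e_homog levP 0).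
- by move=> x y; exact: (ev2_ezC levP dA0 0).
- by move=> x y z t; exact: (ev_level levP dA0).
Qed.

End SteenrodAction.

Theorem theorem3p3p4 (P : dgOperad) (e : nat -> P 2%N)
    (G : nat -> nat -> P 4%N) (hP : isLevAC e G)
    (A : opAlgebra P) (hA : forall x : A, dalg x = 0) :
  exists b2act : B2 -> A -> A,
    isUnstableLevelAlgebra (fun x y => ev2 (e 0%N) x y) b2act /\
    forall (k r : int) (x : A), homog k x ->
      b2act (Sq r) x = ev2 (ez e (k - r)) x x.
Proof.
have SqE r (x : A) : b2_act e (Sq r) x = steenrod e r x.
  exact: (b2_act_pi hP hA).
exists (b2_act e (A := A)); split; last first.
  by move=> k r x kx; rewrite SqE (steenrod_homog _ _ kx).
split.
- exact (level_graded hP hA).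
- exact (b2_act_graded hP hA).
- by move=> k n x kx kn; rewrite SqE (steenrod_unstable _ kx kn).
- by move=> k x kx; rewrite SqE (steenrod_homog _ _ kx) subrr.
move=> k l s x y kx ly; rewrite SqE (steenrod_cartan hP hA s kx ly).
by apply: eq_fsbigr => t _; rewrite !SqE.
Qed.
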